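(* Let $a>0$, $b\in\mathbb R$, $n\ge 1$, and let $f:S^n\to\mathbb R$ be positive definite and symmetric (invariant under permutations of its $n$ arguments). (1) If $b>0$, then for all $t\ge 0$, $U^a_n(t)f\le T^{a,b}_n(t)f$ (pointwise on $S^n$). (2) If $b<0$ and $(T^{a,b}_n(t))_{t\ge 0}$ is a Markov semigroup, then for all $t\ge 0$, $U^a_n(t)f\ge T^{a,b}_n(t)f$ (pointwise on $S^n$).
   Context: $S$ is either a finite set or $S=\mathbb Z^d$. $p(x,y)$ is an irreducible symmetric random walk transition probability on $S$: $p(x,y)=p(y,x)\ge 0$, $\sum_y p(x,y)=1$, $p(x,x)=0$. If $S=\mathbb Z^d$, $p$ is moreover translation invariant and of finite range: $p(x,y)=\pi(y-x)$ and there is $R>0$ with $p(x,y)=0$ for $|x-y|>R$. For $x=(x_1,\dots,x_n)\in S^n$, $1\le i\le n$ and $y\in S$, write $x^{x_i,y}=(x_1,\dots,x_{i-1},y,x_{i+1},\dots,x_n)$. For functions $f:S^n\to\mathbb R$ define $$\mathcal L^{a,b}_n f(x)=\sum_{i=1}^n\sum_{y\in S}p(x_i,y)\Big(a+b\sum_{j=1}^n I(y=x_j)\Big)\big(f(x^{x_i,y})-f(x)\big),$$ $$\mathcal L^{a}_{1,n} f(x)=a\sum_{i=1}^n\sum_{y\in S}p(x_i,y)\big(f(x^{x_i,y})-f(x)\big),$$ where $I$ denotes the indicator. $T^{a,b}_n(t)$ is the semigroup on functions $f:S^n\to\mathbb R$ associated to the generator $\mathcal L^{a,b}_n$, and $U^a_n(t)$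 is the semigroup associated to $\mathcal L^a_{1,n}$, i.e. the semigroup of $n$ independent continuous-time random walkers jumping at rate $a$ according to $p$. When $b<0$, $T^{a,b}_n(t)$ is not always a Markov semigroup. A function $g:S\times S\to\mathbb R$ is called positive definite if $\sum_{x,y}g(x,y)\beta(x)\beta(y)\ge0$ for all $\beta:S\to\mathbb R$ with $\sum_x|\beta(x)|<\infty$. A function $f:S^n\to\mathbb R$ is called positive definite if it is positive definite in every pair of variables. *)

(* Defs.v *)
(* MathComp / MathComp-Analysis. *)
From HB Require Import structures.
From mathcomp Require Import all_boot all_order all_algebra all_fingroup.
From mathcomp Require Import all_classical all_reals all_analysis.

Set Implicit Arguments.
Unset Strict Implicit.
Unset Printing Implicit Defensive.

Import Order.TTheory GRing.Theory Num.Theory.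
Import numFieldNormedType.Exports.

Local Open Scope classical_set_scope.
Local Open Scope ring_scope.

(* Unconditional sums of real families; [rsum F] is meaningful only when
   [rsummable F] holds. *)
Definition rsummable (R : realType) (I : choiceType) (F : I -> R) : Prop :=
  summable [set: I] (EFin \o F).

Definition rsum (R : realType) (I : choiceType) (F : I -> R) : R :=
  fine (\esum_(i in [set: I]) ((EFin \o F)^\+ i)%E
        - \esum_(i in [set: I]) ((EFin \o F)^\- i)%E)%E.

Definition random_walk (R : realType) (S : choiceType) (p : S -> S -> R) : Prop :=
  [/\ forall x y, 0 <= p x y,
      forall x y, p x y = p y x,
      forall x, rsummable (p x) /\ rsum (p x) = 1,
      forall x, p x x = 0
    & forall x y, exists2 s : seq S,
        path (fun u v => 0 < p u v) x s & last x s = y].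

Definition euclid_norm (R : realType) (d : nat) (z : 'rV[int]_d) : R :=
  Num.sqrt (\sum_(k < d) ((z ord0 k)%:~R : R) ^+ 2).

Definition translation_invariant (R : realType) (d : nat)
    (p : 'rV[int]_d -> 'rV[int]_d -> R) : Prop :=
  exists pi : 'rV[int]_d -> R, forall x y, p x y = pi (y - x).

Definition finite_range (R : realType) (d : nat)
    (p : 'rV[int]_d -> 'rV[int]_d -> R) : Prop :=
  exists2 r : R, 0 < r & forall x y, r < euclid_norm R (x - y) -> p x y = 0.

Inductive admissible_walk (R : realType) :
    forall S : choiceType, (S -> S -> R) -> Prop :=
| FiniteWalk (S : finType) (p : S -> S -> R) :
    random_walk p -> admissible_walk p
| LatticeWalk (d : nat) (p : 'rV[int]_d -> 'rV[int]_d -> R) :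
    random_walk p -> translation_invariant p -> finite_range p ->
    admissible_walk p.

Definition config (n : nat) (S : choiceType) : choiceType := {ffun 'I_n -> S}.

Definition jump (n : nat) (S : choiceType) (x : config n S) (i : 'I_n) (y : S) :
    config n S :=
  [ffun j => if j == i then y else x j].

Definition gen_ab (R : realType) (S : choiceType) (p : S -> S -> R) (a b : R)
    (n : nat) (f : config n S -> R) (x : config n S) : R :=
  \sum_(i < n) rsum (fun y : S =>
    p (x i) y * (a + b * \sum_(j < n) (y == x j)%:R) * (f (jump x i y) - f x)).

Definition gen_1 (R : realType) (S : choiceType) (p : S -> S -> R) (a : R)
    (n : nat) (f : config n S -> R) (x : config n S) : R :=
  a * \sum_(i < n) rsum (fun y : S => p (x i) y * (f (jump x i y) - f x)).

(* [e^{tL} g], for an operator [L] bounded in the supremum norm and a bounded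
   function [g].  Both generators above are bounded: their total jump rates
   from [x] are at most [n * (`|a| + n * `|b|)]. *)
Definition expgen (R : realType) (X : choiceType) (L : (X -> R) -> X -> R)
    (t : R) (g : X -> R) (x : X) : R :=
  limn (series (fun k : nat => exp_coeff t k * iter k L g x)).

(* [p_t(x, y) = (e^{tL} 1_{y})(x)]. *)
Definition transition (R : realType) (X : choiceType) (L : (X -> R) -> X -> R)
    (t : R) (x y : X) : R :=
  expgen L t (fun z => (z == y)%:R) x.

(* The semigroup with generator [L].  For bounded [f] the sum converges
   absolutely and equals [e^{tL} f]; an unbounded [f] on an infinite space need
   not be integrable against [p_t(x, .)], whence [in_semigroup_domain]. *)
Definition semigroup (R : realType) (X : choiceType) (L : (X -> R) -> X -> R)
    (t : R) (f : X -> R) (x : X) : R :=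
  rsum (fun y => transition L t x y * f y).

Definition in_semigroup_domain (R : realType) (X : choiceType)
    (L : (X -> R) -> X -> R) (t : R) (f : X -> R) (x : X) : Prop :=
  rsummable (fun y => transition L t x y * f y).

(* The semigroup law and continuity in [t] are not required here: they hold for
   every bounded generator. *)
Definition markov_semigroup (R : realType) (X : choiceType)
    (T : R -> (X -> R) -> X -> R) : Prop :=
  forall t : R, 0 <= t ->
    (forall x, T t (fun=> 1) x = 1) /\
    (forall f : X -> R, (exists M : R, forall x, `|f x| <= M) ->
       (forall x, 0 <= f x) -> forall x, 0 <= T t f x).

(* For bounded [g] the second summability condition holds for every summable
   [beta]; for unbounded [g] the condition is imposed whenever the double sum
   makes sense, in particular for all finitely supported [beta]. *)
Definition positive_definite2 (R : realType) (S : choiceType)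
    (g : S -> S -> R) : Prop :=
  forall beta : S -> R, rsummable beta ->
    rsummable (fun u : S * S => g u.1 u.2 * beta u.1 * beta u.2) ->
    0 <= rsum (fun u : S * S => g u.1 u.2 * beta u.1 * beta u.2).

Definition positive_definite (R : realType) (S : choiceType) (n : nat)
    (f : config n S -> R) : Prop :=
  forall (i j : 'I_n), i != j -> forall x : config n S,
    positive_definite2 (fun u v => f (jump (jump x i u) j v)).

Definition symmetric_fun (R : realType) (S : choiceType) (n : nat)
    (f : config n S -> R) : Prop :=
  forall (s : {perm 'I_n}) (x : config n S), f [ffun i => x (s i)] = f x.

Definition semigroup_T (R : realType) (S : choiceType) (p : S -> S -> R)
    (a b : R) (n : nat) : R -> (config n S -> R) -> config n S -> R :=
  semigroup (gen_ab p a b (n := n)).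

Definition semigroup_U (R : realType) (S : choiceType) (p : S -> S -> R)
    (a : R) (n : nat) : R -> (config n S -> R) -> config n S -> R :=
  semigroup (gen_1 p a (n := n)).

(* Main.v *)
(* Both generators are bounded, so expgen L t f is the limit of (1 + (t/N) L)^N f,
   and truncating f to boxes B^n, which preserves symmetry and positive
   definiteness, reduces everything to finitely supported f.  The generators
   differ by b times
     sum_(i, j) p(x_i, x_j) (g(x^{x_i, x_j}) - g(x)),
   which is nonnegative when g is symmetric and positive definite.  This sign is
   needed along a discretization of U^a(t) f that preserves both properties: the
   Euler step 1 + h L_1 does not, but it agrees up to O(h^2) with
   prod_i (1 + h a (P_i - 1)), the step of n independent lazy walkers, which
   does.  Comparing N steps with positive, shift-equivariant operators
   accumulates an error of order 1/N. *)
Require Import Defs.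
From HB Require Import structures.
From mathcomp Require Import all_boot all_order all_algebra all_fingroup.
From mathcomp Require Import all_classical all_reals all_analysis.
From mathcomp Require Import zify ring lra.

Set Implicit Arguments.
Unset Strict Implicit.
Unset Printing Implicit Defensive.

Import Order.TTheory GRing.Theory Num.Theory.
Import numFieldNormedType.Exports.

Local Open Scope classical_set_scope.
Local Open Scope ring_scope.

(** * Unconditional sums as limits of finite sums *)

Section UnconditionalSums.
Context {R : realType} {T : choiceType}.

(** A finite set nearly attaining the supremum exists by definition of [\esum]; since the terms are
    nonnegative, every larger finite set does at least as well. *)
Lemma esum_approx (A : T -> R) : (forall i, 0 <= A i) ->
  (\esum_(i in [set: T]) (A i)%:E < +oo)%E ->
  forall e : R, 0 < e -> exists F : seq T, forall s, uniq s -> {subset F <= s} ->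
    fine (\esum_(i in [set: T]) (A i)%:E) - e <= \sum_(i <- s) A i <=
    fine (\esum_(i in [set: T]) (A i)%:E).
Proof.
move=> A0 Afin e e0.
have Enum : (\esum_(i in [set: T]) (A i)%:E)%E \is a fin_num.
  by rewrite ge0_fin_numE// esum_ge0// => i _; rewrite lee_fin.
have [_ [X [finX _] <-] Xe] := ub_ereal_sup_adherent e0 Enum.
exists (finmap.enum_fset (fset_set X)) => s us sub.
have -> : \sum_(i <- s) A i = fine (\sum_(i \in [set` s]) (A i)%:E).
  by rewrite -fsbig_seq// sumEFin.
have sE : (\sum_(i \in [set` s]) (A i)%:E)%E \is a fin_num.
  by rewrite -fsbig_seq// sumEFin.
apply/andP; split.
  rewrite -lee_fin EFinB !fineK//.
  apply: (le_trans (ltW Xe)); apply: lee_fsum_nneg_subset => //.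
  - move=> i; rewrite !inE => Xi; apply: sub.
    by rewrite in_fset_set// inE.
  - by move=> i _; rewrite lee_fin.
rewrite -lee_fin !fineK//; by apply: ereal_sup_ubound; exists [set` s].
Qed.

(** The positive and negative parts are each approximated within [e / 2]. *)
Lemma rsum_approx (G : T -> R) : rsummable G ->
  forall e : R, 0 < e -> exists F : seq T, forall s, uniq s -> {subset F <= s} ->
    `|rsum G - \sum_(i <- s) G i| <= e.
Proof.
move=> Gs e e0; have e20 : 0 < e / 2 by rewrite divr_gt0.
have posE : ((EFin \o G)^\+)%E = (fun i => (Num.max (G i) 0)%:E).
  by apply/funext => i; rewrite funeposE /= EFin_max.
have negE : ((EFin \o G)^\-)%E = (fun i => (Num.max (- G i) 0)%:E).
  by apply/funext => i; rewrite funenegE /= EFin_max.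
have fin_of : forall A : T -> R, (forall i, 0 <= A i) -> (forall i, A i <= `|G i|) ->
    (\esum_(i in [set: T]) (A i)%:E < +oo)%E.
  move=> A A0 AG; apply: le_lt_trans Gs; apply: le_esum => i _ /=.
  by rewrite lee_fin.
have P0 i : 0 <= Num.max (G i) 0 by rewrite le_max lexx orbT.
have N0 i : 0 <= Num.max (- G i) 0 by rewrite le_max lexx orbT.
have Pf := fin_of _ P0 (fun i => ltac:(by rewrite ge_max normr_ge0 ler_norm)).
have Nf := fin_of _ N0
  (fun i => ltac:(by rewrite ge_max normr_ge0 -(normrN (G i)) ler_norm)).
have [F1 h1] := esum_approx P0 Pf e20; have [F2 h2] := esum_approx N0 Nf e20.
exists (F1 ++ F2) => s us sub.
have /andP[a1 a2] := h1 s us (fun i Hi => sub i ltac:(by rewrite mem_cat Hi)).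
have /andP[b1 b2] := h2 s us (fun i Hi => sub i ltac:(by rewrite mem_cat Hi orbT)).
rewrite /rsum posE negE.
have GE : \sum_(i <- s) G i =
    \sum_(i <- s) Num.max (G i) 0 - \sum_(i <- s) Num.max (- G i) 0.
  rewrite -sumrB; apply: eq_bigr => i _.
  case: (leP 0 (G i)) => Gi.
    by rewrite (max_idPr _) ?oppr_le0// subr0.
  by rewrite (max_idPl _) ?oppr_ge0 ?ltW// sub0r opprK.
rewrite GE fineB; last 2 first.
- by rewrite ge0_fin_numE ?esum_ge0// => i _; rewrite lee_fin.
- by rewrite ge0_fin_numE ?esum_ge0// => i _; rewrite lee_fin.
by rewrite ler_norml; apply/andP; split; lra.
Qed.

Lemma rsummable_fin (s : seq T) (F : T -> R) :
  (forall i, i \notin s -> F i = 0) -> rsummable F.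
Proof.
move=> F0; rewrite /rsummable /summable.
have -> : (\esum_(x in [set: T]) `|(EFin \o F) x|)%E =
    (\esum_(x in [set` s]) `|F x|%:E)%E.
  rewrite [RHS]esum_mkcond; apply: eq_esum => i _ /=.
  rewrite mem_setE.
  by case: ifPn => // /F0 ->; rewrite normr0.
rewrite esum_fset; last 2 first.
- exact: finite_seq.
- by move=> i _; rewrite lee_fin.
have -> : [set` s] = [set` undup s] by apply/seteqP; split => i /=; rewrite mem_undup.
by rewrite -fsbig_seq ?undup_uniq// sumEFin ltry.
Qed.

Lemma rsum_fin (s : seq T) (F : T -> R) : uniq s ->
  (forall i, i \notin s -> F i = 0) -> rsum F = \sum_(i <- s) F i.
Proof.
move=> us F0; apply/eqP; rewrite -subr_eq0 -normr_le0; apply/ler_addgt0Pl => e e0.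
rewrite addr0; have [X hX] := rsum_approx (rsummable_fin F0) e0.
(* Enlarging [s] by the points of [X] outside it only adds zero terms, and the result contains
   [X]. *)
suff -> : \sum_(i <- s) F i = \sum_(i <- s ++ [seq x <- undup X | x \notin s]) F i.
  apply: hX.
    rewrite cat_uniq us filter_uniq ?undup_uniq// andbT.
    by apply/hasPn => x; rewrite mem_filter => /andP[].
  by move=> x Xx; rewrite mem_cat mem_filter mem_undup Xx andbT orbN.
rewrite big_cat /= [X in _ = _ + X]big1_seq ?addr0// => x /=.
by rewrite mem_filter => /andP[/F0].
Qed.

End UnconditionalSums.

(** * Scalar estimates for the Euler approximation of the exponential *)

Lemma ffact_leq_exp m k : (m ^_ k <= m ^ k)%N.
Proof.
elim: k => [|k IH]; first by rewrite ffactn0.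
by rewrite ffactnSr expnSr leq_mul// leq_subr.
Qed.

Lemma bin_expN_le (R : realType) m k :
  'C(m.+1, k)%:R / m.+1%:R ^+ k <= (k`!%:R)^-1 :> R.
Proof.
rewrite ler_pdivrMr ?exprn_gt0// mulrC ler_pdivlMr ?ltr0n ?fact_gt0//.
by rewrite -natrM -natrX ler_nat bin_ffact ffact_leq_exp.
Qed.

(** With [u = s / (m + 1)], the bound [1 - u <= expR (- u)] gives [expR u * (1 - u ^+ 2) <= 1 + u].
    Raise this to the power [m + 1] and apply Bernoulli's inequality to [1 - u ^+ 2]. *)
Lemma exp_sub_euler_le (R : realType) (s : R) m : 0 <= s -> s <= m.+1%:R ->
  expR s - (1 + s / m.+1%:R) ^+ m.+1 <= expR s * (s ^+ 2 / m.+1%:R).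
Proof.
move=> s0 sm; set u := s / m.+1%:R.
have m0 : 0 < m.+1%:R :> R by [].
have u0 : 0 <= u by rewrite divr_ge0.
have u1 : u <= 1 by rewrite ler_pdivrMr// mul1r.
have eN : expR s = expR u ^+ m.+1 by rewrite -expRM_natl mulrC divfK// gt_eqF.
have step : expR u * (1 - u ^+ 2) <= 1 + u.
  have -> : 1 - u ^+ 2 = (1 - u) * (1 + u) by ring.
  rewrite mulrA -[leRHS]mul1r ler_wpM2r ?addr_ge0//.
  have := expR_ge1Dx (- u); rewrite expRN => h.
  by rewrite mulrC -ler_pdivlMr ?expR_gt0// mul1r.
have bern : 1 - m.+1%:R * u ^+ 2 <= (1 - u ^+ 2) ^+ m.+1.
  have w1 : u ^+ 2 <= 1 by rewrite expr_le1.
  have w0 : 0 <= u ^+ 2 by rewrite exprn_ge0.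
  elim: (m.+1) => [|k IH]; first by rewrite mul0r subr0 expr0.
  have v0 : 0 <= 1 - u ^+ 2 by rewrite subr_ge0.
  rewrite [leRHS]exprS; apply: (le_trans _ (ler_wpM2l v0 IH)); rewrite -natr1.
  have kw : 0 <= k%:R * (u ^+ 2 * u ^+ 2) :> R by rewrite !mulr_ge0.
  nra.
have : expR s * (1 - m.+1%:R * u ^+ 2) <= (1 + u) ^+ m.+1.
  apply: (le_trans (ler_wpM2l (expR_ge0 s) bern)).
  rewrite eN -exprMn; apply: lerXn2r; rewrite ?nnegrE ?addr_ge0//.
  by rewrite mulr_ge0 ?expR_ge0// subr_ge0 expr_le1.
have -> : m.+1%:R * u ^+ 2 = s ^+ 2 / m.+1%:R.
  by rewrite /u expr_div_n expr2 [X in _ / X]expr2; field; rewrite gt_eqF.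
by rewrite mulrBr mulr1 lerBlDr -lerBlDl.
Qed.

(** * Exponentials of bounded operators as limits of Euler iterates *)

Section Euler.
Context {R : realType} {X : choiceType}.
Variables (L : (X -> R) -> X -> R) (C : R).
Hypothesis C0 : 0 <= C.
Hypothesis Llin : forall (c : R) (g h : X -> R) x,
  L (fun z => g z + c * h z) x = L g x + c * L h x.
Hypothesis Lbnd : forall (g : X -> R) (M : R) x,
  (forall z, `|g z| <= M) -> `|L g x| <= C * M.

Definition euler (h : R) (g : X -> R) : X -> R := fun x => g x + h * L g x.

Lemma iter_lin k c g h x :
  iter k L (fun z => g z + c * h z) x = iter k L g x + c * iter k L h x.
Proof.
elim: k x => //= k IH x.
have -> : iter k L (fun z => g z + c * h z) =
          (fun z => iter k L g z + c * iter k L h z) by apply/funext.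
exact: Llin.
Qed.

Lemma iter_bnd k g M x : (forall z, `|g z| <= M) -> `|iter k L g x| <= C ^+ k * M.
Proof.
move=> gM; elim: k x => [|k IH] x /=; first by rewrite mul1r.
by rewrite exprS -mulrA; apply: Lbnd.
Qed.

Lemma iter_euler N h g x : iter N (euler h) g x =
  \sum_(0 <= k < N.+1) 'C(N, k)%:R * h ^+ k * iter k L g x.
Proof.
elim: N g => [|N IH] g; first by rewrite big_nat1 bin0 expr0 !mul1r.
rewrite iterSr IH.
under eq_bigr => k _.
  rewrite iter_lin mulrDr -iterSr [X in _ + X](_ : _ =
    'C(N, k)%:R * h ^+ k.+1 * iter k.+1 L g x); last by rewrite exprSr !mulrA.
  over.
rewrite big_split /= [RHS]big_nat_recl// bin0.
under [X in _ = _ + X]eq_bigr => k _ do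
  rewrite binS natrD mulrDl mulrDl.
rewrite big_split /= addrA; congr (_ + _).
by rewrite [LHS]big_nat_recl// bin0 [in RHS]big_nat_recr//= bin_small// !mul0r addr0.
Qed.

Section Bounded.
Variables (g : X -> R) (M : R).
Hypothesis gM : forall z, `|g z| <= M.
Variable t : R.
Hypothesis t0 : 0 <= t.

Lemma expgen_coeff_le x k :
  `|exp_coeff t k * iter k L g x| <= M * exp_coeff (t * C) k.
Proof.
rewrite normrM ger0_norm ?exp_coeff_ge0//.
apply: (le_trans (ler_wpM2l (exp_coeff_ge0 _ t0) (iter_bnd k x gM))).
by rewrite /exp_coeff /= exprMn le_eqVlt; apply/orP; left; apply/eqP; ring.
Qed.

Lemma expgen_cvg x :
  series (fun k => exp_coeff t k * iter k L g x) @ \oo --> expgen L t g x.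
Proof.
apply: normed_cvg.
apply: (@series_le_cvg _ _ (fun k => M * exp_coeff (t * C) k)) => [k|k|k|].
- exact: normr_ge0.
- exact: le_trans (expgen_coeff_le x k).
- exact: expgen_coeff_le.
- exact: (is_cvg_seriesZ (k := M) (is_cvg_series_exp_coeff (t * C))).
Qed.

(** By [bin_expN_le], each coefficient of the exponential series dominates the matching coefficient
    of the Euler polynomial. Bounding [iter k L g] by [C ^+ k * M] therefore turns the operator
    error into [M] times the scalar error at [t * C]. *)
Lemma expgen_euler_le x N :
  `|expgen L t g x - iter N.+1 (euler (t / N.+1%:R)) g x| <=
  M * (expR (t * C) - (1 + t * C / N.+1%:R) ^+ N.+1).
Proof.
set E := iter _ _ _ _; set B := (1 + _) ^+ _.
have cl : (fun K => `|series (fun k => exp_coeff t k * iter k L g x) K - E|) @ \oo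
    --> `|expgen L t g x - E|.
  by apply: cvg_norm; apply: cvgB; [exact: expgen_cvg|exact: cvg_cst].
have cr : (fun K => M * (series (exp_coeff (t * C)) K - B)) @ \oo
    --> M * (expR (t * C) - B).
  by apply: cvgMr; apply: cvgB; [exact: is_cvg_series_exp_coeff|exact: cvg_cst].
apply: (ler_cvg_to cl cr); near=> K.
have NK : (N.+2 <= K)%N by near: K; exact: nbhs_infty_ge.
(* The binomial coefficients vanish past [N.+1], so the Euler polynomials can be compared term by
   term with partial sums of any length [K >= N.+2]. *)
have extend (c : nat -> R) : \sum_(0 <= k < N.+2) 'C(N.+1, k)%:R * c k =
    \sum_(0 <= k < K) 'C(N.+1, k)%:R * c k.
  rewrite [RHS](big_cat_nat _ NK)//= [X in _ = _ + X]big1_seq ?addr0// => k /=.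
  by rewrite mem_index_iota => /andP[Nk _]; rewrite bin_small// mul0r.
have EE : E = \sum_(0 <= k < K) 'C(N.+1, k)%:R *
    ((t / N.+1%:R) ^+ k * iter k L g x).
  by rewrite /E iter_euler -extend; apply: eq_bigr => k _; rewrite mulrA.
have BE : B = \sum_(0 <= k < K) 'C(N.+1, k)%:R * (t * C / N.+1%:R) ^+ k.
  rewrite -extend /B exprDn big_mkord; apply: eq_bigr => k _.
  by rewrite expr1n mul1r mulr_natl.
rewrite EE BE /series /= -!sumrB mulr_sumr.
apply: (le_trans (ler_norm_sum _ _ _)); apply: ler_sum => k _.
set d : R := (k`!%:R)^-1 - 'C(N.+1, k)%:R / N.+1%:R ^+ k.
have d0 : 0 <= d by rewrite subr_ge0 bin_expN_le.
have -> : exp_coeff t k * iter k L g x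
    - 'C(N.+1, k)%:R * ((t / N.+1%:R) ^+ k * iter k L g x)
    = d * t ^+ k * iter k L g x.
  by rewrite /exp_coeff /= /d expr_div_n; ring.
have -> : exp_coeff (t * C) k - 'C(N.+1, k)%:R * (t * C / N.+1%:R) ^+ k
    = d * t ^+ k * C ^+ k.
  by rewrite /exp_coeff /= /d expr_div_n exprMn; ring.
have dt0 : 0 <= d * t ^+ k by rewrite mulr_ge0 ?exprn_ge0.
rewrite normrM ger0_norm//.
apply: (le_trans (ler_wpM2l dt0 (iter_bnd k x gM))).
suff -> : d * t ^+ k * (C ^+ k * M) = M * (d * t ^+ k * C ^+ k) by []. 
  by ring.
Unshelve. all: by end_near. Qed.

Lemma euler_cvg x :
  (fun N => iter N.+1 (euler (t / N.+1%:R)) g x) @ \oo --> expgen L t g x.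
Proof.
have M0 : 0 <= M by apply: le_trans (gM x).
have s0 : 0 <= t * C by rewrite mulr_ge0.
set K := M * (expR (t * C) * (t * C) ^+ 2).
have cK : (fun N => K * harmonic N) @ \oo --> (0 : R).
  by rewrite -[X in _ --> X](mulr0 K); apply: cvgMr; exact: cvg_harmonic.
apply: (@squeeze_cvgr _ _ _ _ (fun N => expgen L t g x - K * harmonic N)
  (fun N => expgen L t g x + K * harmonic N)).
- near=> N.
  have sN : t * C <= N.+1%:R.
    near: N; have [m mP] : exists m : nat, t * C <= m%:R.
      by exists (Num.bound (t * C)); rewrite ltW// archi_boundP.
    exists m => // N /= mN; apply: (le_trans mP); rewrite ler_nat; exact: leqW.
  have := le_trans (expgen_euler_le x N) (ler_wpM2l M0 (exp_sub_euler_le s0 sN)).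
  have -> : M * (expR (t * C) * ((t * C) ^+ 2 / N.+1%:R)) = K * harmonic N.
    by rewrite /K /harmonic /= !mulrA.
  by rewrite ler_norml => /andP[h1 h2]; apply/andP; split; lra.
- rewrite -[X in _ --> X]subr0; apply: cvgB => //; exact: cvg_cst.
- rewrite -[X in _ --> X]addr0; apply: cvgD => //; exact: cvg_cst.
Unshelve. all: by end_near. Qed.

(** This is the error estimate for a single Euler step; it serves to differentiate the semigroup at
    time [0]. *)
Lemma expgen_first_order_le x : t * C <= 1 ->
  `|expgen L t g x - (g x + t * L g x)| <= M * expR 1 * (t * C) ^+ 2.
Proof.
move=> s1; have M0 : 0 <= M by apply: le_trans (gM x).
have s0 : 0 <= t * C by rewrite mulr_ge0.
have := le_trans (expgen_euler_le x 0) (ler_wpM2l M0 (@exp_sub_euler_le _ _ 0 s0 s1)).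
rewrite /= /euler !divr1 => /le_trans; apply.
by rewrite -mulrA ler_wpM2l// ler_wpM2r ?exprn_ge0// ler_expR.
Qed.

End Bounded.

Lemma iter_lin_sum k (I : Type) (s : seq I) (c : I -> R) (G : I -> X -> R) x :
  iter k L (fun z => \sum_(i <- s) c i * G i z) x =
  \sum_(i <- s) c i * iter k L (G i) x.
Proof.
elim: s => [|i s IH].
  (* Written this way, the zero function is sent to zero by [iter_lin] alone. *)
  rewrite big_nil (_ : (fun z => _) = fun z => 0 + (-1) * 0); last first.
    by apply/funext => z; rewrite big_nil mulr0 addr0.
  by rewrite (iter_lin k (-1) (fun=> 0) (fun=> 0)) mulN1r subrr.
rewrite big_cons -IH (_ : (fun z => _) = (fun z =>
    (\sum_(j <- s) c j * G j z) + c i * G i z)) ?iter_lin 1?addrC//.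
by apply/funext => z; rewrite big_cons addrC.
Qed.

(** A finitely supported function is a finite combination of indicators, and linearity passes
    through the partial sums to the limit. This links the kernel sums defining [semigroup] to the
    operator exponential. *)
Lemma expgen_transition t (f : X -> R) (s : seq X) x : 0 <= t -> uniq s ->
  (forall y, y \notin s -> f y = 0) ->
  expgen L t f x = \sum_(y <- s) transition L t x y * f y.
Proof.
move=> t0 us f0; apply/cvg_lim => //.
have fE : f = fun z => \sum_(y <- s) f y * (z == y)%:R.
  apply/funext => z; have [zs|zs] := boolP (z \in s).
    rewrite (bigD1_seq z)//= eqxx mulr1 big1 ?addr0// => y /negbTE.
    by rewrite eq_sym => ->; rewrite mulr0.
  rewrite f0// big1_seq// => y /= ys; rewrite eq_sym.
  by rewrite (negbTE (memPn zs _ ys)) mulr0.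
rewrite {1}fE (_ : series _ = fun K => \sum_(y <- s) f y *
    series (fun k => exp_coeff t k * iter k L (fun z => (z == y)%:R) x) K); last first.
  apply/funext => K; rewrite /series /=.
  under eq_bigr do rewrite iter_lin_sum mulr_sumr.
  rewrite exchange_big /=; apply: eq_bigr => y _; rewrite mulr_sumr.
  by apply: eq_bigr => k _; rewrite mulrCA.
under [X in _ --> X]eq_bigr do rewrite mulrC.
apply: cvg_big => [|y _]; first exact: add_continuous.
apply: cvgMr; apply: (@expgen_cvg _ 1) => // z.
by rewrite ger0_norm//; case: eqP.
Qed.
End Euler.

(** Monotonicity and commutation with constants let [V] carry the accumulated error along without
    amplifying it, so [N] steps cost [N * e]. The one-step comparison is made only at the iterates
    of [W], where structural properties of [f] can be propagated. *)
Lemma iter_le_perturb (R : realType) (X : Type) (V W : (X -> R) -> X -> R)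
    (f : X -> R) (e : R) :
  (forall g h, (forall x, g x <= h x) -> forall x, V g x <= V h x) ->
  (forall g c x, V (fun z => g z + c) x = V g x + c) ->
  (forall k x, iter k.+1 W f x <= V (iter k W f) x + e) ->
  forall N x, iter N W f x <= iter N V f x + N%:R * e.
Proof.
move=> Vmono Vcst WV; elim=> [|N IH] x; first by rewrite mul0r addr0.
apply: (le_trans (WV N x)); rewrite -natr1 mulrDl mul1r addrA lerD2r /=.
by rewrite -Vcst; apply: Vmono.
Qed.

Lemma iter_ge_perturb (R : realType) (X : Type) (V W : (X -> R) -> X -> R)
    (f : X -> R) (e : R) :
  (forall g h, (forall x, g x <= h x) -> forall x, V g x <= V h x) ->
  (forall g c x, V (fun z => g z + c) x = V g x + c) ->
  (forall k x, V (iter k W f) x <= iter k.+1 W f x + e) ->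
  forall N x, iter N V f x <= iter N W f x + N%:R * e.
Proof.
move=> Vmono Vcst WV; elim=> [|N IH] x; first by rewrite mul0r addr0.
have h := Vmono _ _ IH x; apply: (le_trans h).
by rewrite Vcst -natr1 mulrDl mul1r addrA addrAC lerD2r WV.
Qed.

(** * The generators, for a walk whose jumps from [x] lie in a finite list [nb x] *)

Section FiniteJumps.
Context {R : realType} {S : choiceType} {n : nat}.
Variables (p : S -> S -> R) (nb : S -> seq S).
Hypothesis p_ge0 : forall x y, 0 <= p x y.
Hypothesis p_sym : forall x y, p x y = p y x.
Hypothesis p_diag : forall x, p x x = 0.
Hypothesis nb_uniq : forall x, uniq (nb x).
Hypothesis p_out : forall x y, y \notin nb x -> p x y = 0.
Hypothesis p_sum1 : forall x, \sum_(y <- nb x) p x y = 1.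

Local Notation conf := (config n S).
Local Notation gen a b := (@gen_ab R S p a b n).
Implicit Types (x : conf) (g : conf -> R) (i j k : 'I_n) (u v y : S).

Lemma jumpE x i u k : jump x i u k = if k == i then u else x k.
Proof. by rewrite ffunE. Qed.

Lemma jump_id x i : jump x i (x i) = x.
Proof. by apply/ffunP => k; rewrite jumpE; case: eqP => [->|]. Qed.

Lemma jumpC x i j u v : i != j -> jump (jump x i u) j v = jump (jump x j v) i u.
Proof.
move=> ij; apply/ffunP => k; rewrite !jumpE.
by case: (eqVneq k j) => [->|//]; rewrite eq_sym (negbTE ij).
Qed.

Definition jump_rate (a b : R) x y : R := a + b * \sum_(j < n) (y == x j)%:R.

Lemma jump_rate_le a b x y : `|jump_rate a b x y| <= `|a| + `|b| * n%:R.
Proof.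
apply: (le_trans (ler_normD _ _)); rewrite lerD2l normrM ler_wpM2l//.
rewrite ger0_norm ?sumr_ge0//.
apply: (@le_trans _ _ (\sum_(j < n) 1)); first by apply: ler_sum => j _; case: eqP.
by rewrite sumr_const card_ord.
Qed.

Lemma gen_abE a b g x : gen_ab p a b g x =
  \sum_(i < n) \sum_(y <- nb (x i))
    p (x i) y * jump_rate a b x y * (g (jump x i y) - g x).
Proof.
apply: eq_bigr => i _; apply: rsum_fin => // y /p_out ->.
by rewrite !mul0r.
Qed.

(** Both generators thus belong to one family, and the theorem compares two values of [b]. *)
Lemma gen_1E a g x : gen_1 p a g x = gen_ab p a 0 g x.
Proof.
rewrite gen_abE /gen_1 mulr_sumr; apply: eq_bigr => i _.
rewrite (@rsum_fin _ _ (nb (x i)))// => [|y /p_out ->]; last by rewrite mul0r.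
rewrite mulr_sumr; apply: eq_bigr => y _.
by rewrite /jump_rate mul0r addr0 mulrA [a * _]mulrC.
Qed.

Lemma gen_ab_lin a b (c : R) g h x :
  gen_ab p a b (fun z => g z + c * h z) x = gen_ab p a b g x + c * gen_ab p a b h x.
Proof.
rewrite !gen_abE mulr_sumr -big_split /=; apply: eq_bigr => i _.
by rewrite mulr_sumr -big_split /=; apply: eq_bigr => y _; ring.
Qed.

Lemma avg_le (c : R) (F : S -> R) u :
  (forall y, F y <= c) -> \sum_(y <- nb u) p u y * F y <= c.
Proof.
move=> Fc; rewrite -[leRHS]mul1r -(p_sum1 u) mulr_suml.
by apply: ler_sum => y _; rewrite ler_wpM2l.
Qed.

Lemma sum_p_le (c : R) (F : 'I_n -> S -> R) x :
  (forall i y, F i y <= c) ->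
  \sum_(i < n) \sum_(y <- nb (x i)) p (x i) y * F i y <= n%:R * c.
Proof.
move=> Fc; rewrite mulr_natl -[X in _ *+ X]card_ord -sumr_const.
by apply: ler_sum => i _; apply: avg_le.
Qed.

Lemma gen_ab_bnd a b g (M : R) x : (forall z, `|g z| <= M) ->
  `|gen_ab p a b g x| <= 2 * n%:R * (`|a| + `|b| * n%:R) * M.
Proof.
move=> gM; rewrite gen_abE.
have -> : 2 * n%:R * (`|a| + `|b| * n%:R) * M =
  n%:R * ((`|a| + `|b| * n%:R) * (2 * M)) by ring.
apply: (le_trans (ler_norm_sum _ _ _)).
apply: (@le_trans _ _ (\sum_(i < n) \sum_(y <- nb (x i))
  p (x i) y * `|jump_rate a b x y * (g (jump x i y) - g x)|)).
  apply: ler_sum => i _; apply: (le_trans (ler_norm_sum _ _ _)).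
  by apply: ler_sum => y _; rewrite -mulrA normrM ger0_norm.
apply: sum_p_le => i y; rewrite normrM; apply: ler_pM => //.
  exact: jump_rate_le.
apply: (le_trans (ler_normB _ _)); rewrite mulr_natl mulr2n.
exact: lerD.
Qed.

Lemma euler_shift a b (h : R) g (c : R) x :
  euler (gen a b) h (fun z => g z + c) x = euler (gen a b) h g x + c.
Proof.
rewrite /euler addrAC; congr (_ + _ * _ + _); rewrite !gen_abE.
apply: eq_bigr => i _; apply: eq_bigr => y _; congr (_ * _); ring.
Qed.

(** For [d = g' - g >= 0], the gain terms are nonnegative because the rates are, and the loss at [x]
    is at most [h] times the total rate times [d x], hence at most [d x]. *)
Lemma euler_mono a b (h : R) g g' : 0 <= h ->
  h * (n%:R * (`|a| + `|b| * n%:R)) <= 1 ->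
  (forall x i y, 0 <= p (x i) y * jump_rate a b x y) ->
  (forall x, g x <= g' x) ->
  forall x, euler (gen a b) h g x <= euler (gen a b) h g' x.
Proof.
move=> h0 h1 r0 gg' x; rewrite -subr_ge0.
pose d z := g' z - g z; have d0 z : 0 <= d z by rewrite subr_ge0.
have -> : euler (gen a b) h g' x - euler (gen a b) h g x =
    d x + h * gen_ab p a b d x.
  have -> : gen_ab p a b d x = gen_ab p a b (fun z => g' z + (-1) * g z) x.
    by congr gen_ab; apply/funext => z; rewrite /d mulN1r.
  by rewrite gen_ab_lin /euler /d; ring.
have : \sum_(i < n) \sum_(y <- nb (x i)) p (x i) y * (jump_rate a b x y * d x)
    <= n%:R * ((`|a| + `|b| * n%:R) * d x).
  apply: sum_p_le => i y; rewrite ler_wpM2r//.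
  exact: le_trans (ler_norm _) (jump_rate_le _ _ _ _).
set A := \sum_(i < n) _ => Ale.
have Gge : - A <= gen_ab p a b d x.
  rewrite gen_abE /A -sumrN; apply: ler_sum => i _; rewrite -sumrN.
  apply: ler_sum => y _; rewrite -subr_ge0.
  rewrite (_ : _ - _ = p (x i) y * jump_rate a b x y * d (jump x i y)); last by ring.
  by rewrite mulr_ge0.
have hd := ler_wpM2r (d0 x) h1.
have := ler_wpM2l h0 Ale; have := ler_wpM2l h0 Gge.
rewrite mul1r in hd; move: hd; rewrite -!mulrA; lra.
Qed.

(** * Independent lazy walkers and their distance to an Euler step *)

(* One lazy step of the [i]-th coordinate, [(1 - h) + h P_i], written as a sum
   over weighted target points so that it acts on the test sequences of
   [pd_pair] by substitution. *)
Definition lazy_steps (h : R) u : seq (S * R) :=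
  (u, 1 - h) :: [seq (y, h * p u y) | y <- nb u].

Definition lazy (h : R) i g x : R :=
  \sum_(r <- lazy_steps h (x i)) r.2 * g (jump x i r.1).

Definition lazy_prod (h : R) (s : seq 'I_n) g : conf -> R := foldr (lazy h) g s.

(** This is [P_i - 1], the rate-one generator of the [i]-th walker. *)
Definition walk_diff i g x : R :=
  \sum_(y <- nb (x i)) p (x i) y * (g (jump x i y) - g x).

Lemma lazyE h i g x : lazy h i g x = g x + h * walk_diff i g x.
Proof.
rewrite /lazy /lazy_steps big_cons /= jump_id big_map /= /walk_diff.
under [X in h * X]eq_bigr do rewrite mulrBr.
rewrite sumrB -mulr_suml p_sum1 mulrBr mul1r mulr_sumr.
under eq_bigr do rewrite -mulrA.
by ring.
Qed.

Lemma lazy_steps_sum h u : \sum_(r <- lazy_steps h u) r.2 = 1.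
Proof. by rewrite big_cons big_map /= -mulr_sumr p_sum1 mulr1 subrK. Qed.

Lemma lazy_steps_ge0 h u r : 0 <= h -> h <= 1 -> r \in lazy_steps h u -> 0 <= r.2.
Proof.
move=> h0 h1; rewrite inE => /orP[/eqP ->|/mapP[y _ ->]] /=.
  by rewrite subr_ge0.
by rewrite mulr_ge0.
Qed.

Lemma lazy_mono h i g g' : 0 <= h -> h <= 1 -> (forall x, g x <= g' x) ->
  forall x, lazy h i g x <= lazy h i g' x.
Proof.
move=> h0 h1 gg' x; rewrite /lazy !big_seq; apply: ler_sum => r rs.
by rewrite ler_wpM2l ?(lazy_steps_ge0 h0 h1 rs).
Qed.

Lemma lazy_prod_mono h s g g' : 0 <= h -> h <= 1 -> (forall x, g x <= g' x) ->
  forall x, lazy_prod h s g x <= lazy_prod h s g' x.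
Proof. by move=> h0 h1 gg'; elim: s => //= i s IH x; apply: lazy_mono. Qed.

(** A monotone operator that fixes constants and is applied between the constants [- M] and [M]
    stays between them. *)
Lemma lazy_prod_bnd h s g (M : R) x : 0 <= h -> h <= 1 ->
  (forall z, `|g z| <= M) -> `|lazy_prod h s g x| <= M.
Proof.
move=> h0 h1 gM; have cst (c : R) : lazy_prod h s (fun=> c) x = c.
  elim: s x => //= i s IH x; rewrite (_ : lazy_prod h s _ = fun=> c).
    by rewrite /lazy -mulr_suml lazy_steps_sum mul1r.
  exact/funext.
have gM' z : - M <= g z <= M by rewrite -ler_norml.
rewrite ler_norml; apply/andP; split.
  by rewrite -[- M]cst; apply: lazy_prod_mono => // z; case/andP: (gM' z).
by rewrite -[leRHS]cst; apply: lazy_prod_mono => // z; case/andP: (gM' z).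
Qed.

Lemma walk_diff_bnd i g (M : R) x : (forall z, `|g z| <= M) ->
  `|walk_diff i g x| <= 2 * M.
Proof.
move=> gM; apply: (le_trans (ler_norm_sum _ _ _)).
under eq_bigr do rewrite normrM ger0_norm//.
apply: avg_le => y.
apply: (le_trans (ler_normB _ _)); rewrite mulr_natl mulr2n.
exact: lerD.
Qed.

Lemma walk_diffB i g g' x :
  walk_diff i (fun z => g z - g' z) x = walk_diff i g x - walk_diff i g' x.
Proof. by rewrite -sumrB; apply: eq_bigr => y _; ring. Qed.

Section StepBounds.
Variables (h : R) (g : conf -> R) (M : R).
Hypotheses (h0 : 0 <= h) (h1 : h <= 1) (gM : forall z, `|g z| <= M).

Lemma lazy_prod_near_id s x :
  `|lazy_prod h s g x - g x| <= 2 * (size s)%:R * h * M.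
Proof.
elim: s x => [|i s IH] x /=; first by rewrite subrr normr0 mulr0 !mul0r.
rewrite lazyE addrAC; apply: (le_trans (ler_normD _ _)).
have := walk_diff_bnd i x (fun z => lazy_prod_bnd s z h0 h1 gM).
rewrite normrM (ger0_norm h0) => /(ler_wpM2l h0).
by have := IH x; rewrite -(natr1 (size s)); lra.
Qed.

(** By induction on [s]: a new factor adds its first-order term plus [h * walk_diff i] applied to
    [lazy_prod h s g - g], which is itself of order [h] by [lazy_prod_near_id]. *)
Lemma lazy_prod_first_order s x :
  `|lazy_prod h s g x - (g x + h * \sum_(i <- s) walk_diff i g x)| <=
  4 * (size s)%:R ^+ 2 * h ^+ 2 * M.
Proof.
have M0 : 0 <= M by apply: le_trans (gM x).
elim: s x => [|i s IH] x /=.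
  by rewrite big_nil mulr0 addr0 subrr normr0 expr0n /= mulr0 !mul0r.
rewrite big_cons lazyE.
set G := lazy_prod h s g.
have -> : G x + h * walk_diff i G x
    - (g x + h * (walk_diff i g x + \sum_(j <- s) walk_diff j g x)) =
    G x - (g x + h * \sum_(j <- s) walk_diff j g x)
    + h * walk_diff i (fun z => G z - g z) x.
  by rewrite walk_diffB; ring.
apply: (le_trans (ler_normD _ _)).
have := walk_diff_bnd i x (fun z => lazy_prod_near_id s z).
rewrite normrM (ger0_norm h0) => /(ler_wpM2l h0); have := IH x.
rewrite -(natr1 (size s)).
have : 0 <= (size s)%:R * (h ^+ 2 * M) :> R by rewrite !mulr_ge0 ?exprn_ge0.
have : 0 <= h ^+ 2 * M by rewrite !mulr_ge0 ?exprn_ge0.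
by rewrite !expr2; nra.
Qed.
End StepBounds.

Lemma gen_1_walk_diff a g x :
  gen_ab p a 0 g x = a * \sum_(i < n) walk_diff i g x.
Proof.
rewrite gen_abE mulr_sumr; apply: eq_bigr => i _; rewrite mulr_sumr.
by apply: eq_bigr => y _; rewrite /jump_rate mul0r addr0; ring.
Qed.

Lemma lazy_prod_euler a h g (M : R) x : 0 <= a * h -> a * h <= 1 ->
  (forall z, `|g z| <= M) ->
  `|lazy_prod (a * h) (enum 'I_n) g x - euler (gen a 0) h g x| <=
  4 * n%:R ^+ 2 * (a * h) ^+ 2 * M.
Proof.
move=> h0 h1 gM; have := lazy_prod_first_order h0 h1 gM (enum 'I_n) x.
rewrite size_enum_ord big_enum /= /euler gen_1_walk_diff.
by rewrite [h * (a * _)]mulrA [h * a]mulrC.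
Qed.

(** * Preservation of positive definiteness and symmetry by the lazy walkers *)

(* Positive definiteness in the variables [i] and [j], tested on finite
   families of weighted points, repetitions allowed. *)
Definition pd_pair i j g := forall x (s : seq (S * R)),
  0 <= \sum_(r <- s) \sum_(r' <- s)
         r.2 * r'.2 * g (jump (jump x i r.1) j r'.1).

Lemma jump_other x i u k : k != i -> jump x i u k = x k.
Proof. by rewrite jumpE => /negbTE ->. Qed.

Lemma jump_same x i u : jump x i u i = u.
Proof. by rewrite jumpE eqxx. Qed.

Lemma jump_jump x i u v : jump (jump x i u) i v = jump x i v.
Proof. by apply/ffunP => k; rewrite !jumpE; case: eqP. Qed.

(** A step of a third coordinate only moves the base point [x], so the quadratic form becomes a
    nonnegative mixture of quadratic forms of [g]. *)
Lemma pd_pair_lazy_other h i j k g : 0 <= h -> h <= 1 -> k != i -> k != j ->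
  pd_pair i j g -> pd_pair i j (lazy h k g).
Proof.
move=> h0 h1 ki kj pdg x s.
have -> : \sum_(r <- s) \sum_(r' <- s)
      r.2 * r'.2 * lazy h k g (jump (jump x i r.1) j r'.1) =
    \sum_(q <- lazy_steps h (x k)) q.2 * \sum_(r <- s) \sum_(r' <- s)
      r.2 * r'.2 * g (jump (jump (jump x k q.1) i r.1) j r'.1).
  under [RHS]eq_bigr do rewrite mulr_sumr.
  rewrite [RHS]exchange_big /=; apply: eq_bigr => r _.
  under [RHS]eq_bigr do rewrite mulr_sumr.
  rewrite [RHS]exchange_big /=; apply: eq_bigr => r' _.
  rewrite /lazy !jump_other// mulr_sumr; apply: eq_bigr => q _.
  by rewrite [jump (jump x k _) i _]jumpC// [jump (jump _ k _) j _]jumpC// mulrCA.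
rewrite big_seq; apply: sumr_ge0 => q qs; apply: mulr_ge0; last exact: pdg.
exact: lazy_steps_ge0 qs.
Qed.

(** Stepping both variables with the same kernel moves the kernel onto the weights: the form at [s]
    is the form of [g] at [s'], the image of [s] under one lazy step. *)
Lemma pd_pair_lazy_pair h i j g : i != j -> pd_pair i j g ->
  pd_pair i j (lazy h i (lazy h j g)).
Proof.
move=> ij pdg x s.
set s' := [seq (q.1, r.2 * q.2) | r <- s, q <- lazy_steps h r.1].
suff -> : \sum_(r <- s) \sum_(r' <- s)
      r.2 * r'.2 * lazy h i (lazy h j g) (jump (jump x i r.1) j r'.1) =
    \sum_(r <- s') \sum_(r' <- s') r.2 * r'.2 * g (jump (jump x i r.1) j r'.1).
  exact: pdg.
rewrite [RHS]big_allpairs_dep /=; apply: eq_bigr => r _.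
under [RHS]eq_bigr do rewrite big_allpairs_dep /=.
rewrite [RHS]exchange_big /=; apply: eq_bigr => r' _.
rewrite /lazy jump_other// jump_same mulr_sumr; apply: eq_bigr => q _.
rewrite [jump (jump (jump x _ _) _ _) _ _]jumpC 1?eq_sym// jump_jump jump_same.
rewrite !mulr_sumr; apply: eq_bigr => q' _.
by rewrite jump_jump; ring.
Qed.

Lemma lazyC h i j g : lazy h i (lazy h j g) = lazy h j (lazy h i g).
Proof.
have [->//|ij] := eqVneq i j; apply/funext => x; rewrite /lazy.
under eq_bigr do rewrite jump_other 1?eq_sym// mulr_sumr.
under [RHS]eq_bigr do rewrite jump_other// mulr_sumr.
rewrite exchange_big /=; apply: eq_bigr => q _; apply: eq_bigr => r _.
by rewrite jumpC// mulrCA.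
Qed.

Lemma lazy_prod_perm h s s' g : perm_eq s s' -> lazy_prod h s g = lazy_prod h s' g.
Proof.
move: s s'; apply: (catCA_perm_subst (F := fun s => lazy_prod h s g)) => s1 s2 s3.
rewrite /lazy_prod !foldr_cat; move: (foldr _ _ s3) => G.
elim: s1 G => //= i s1 IH G; rewrite IH; elim: {IH}s2 => //= j s2 <-.
exact: lazyC.
Qed.

(** The factors commute, so [i] and [j] may be brought to the front and treated as a pair; all
    remaining factors avoid both. *)
Lemma pd_pair_lazy_prod h i j g : 0 <= h -> h <= 1 -> i != j ->
  pd_pair i j g -> pd_pair i j (lazy_prod h (enum 'I_n) g).
Proof.
move=> h0 h1 ij pdg.
have iE : i \in enum 'I_n by rewrite mem_enum.
have jE : j \in rem i (enum 'I_n).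
  by rewrite mem_rem_uniq ?enum_uniq// inE mem_enum eq_sym ij.
have E : perm_eq (enum 'I_n) [:: i, j & rem j (rem i (enum 'I_n))].
  by apply: (perm_trans (perm_to_rem iE)); rewrite perm_cons perm_to_rem.
rewrite (lazy_prod_perm _ _ E) /=.
apply: pd_pair_lazy_pair => //.
have : uniq [:: i, j & rem j (rem i (enum 'I_n))] by rewrite -(perm_uniq E) enum_uniq.
rewrite /= inE negb_or => /and3P[/andP[_ ir] jr _].
move: ir jr.
elim: (rem j _) => //= k s IH; rewrite !inE !negb_or => /andP[ik si] /andP[jk sj].
by apply: pd_pair_lazy_other; rewrite 1?eq_sym//; apply: IH.
Qed.

(** Permuting the arguments relabels the factors, and a relabelled enumeration of all coordinates is
    a rearrangement of it. *)
Lemma symmetric_lazy_prod h g :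
  symmetric_fun g -> symmetric_fun (lazy_prod h (enum 'I_n) g).
Proof.
move=> gsym sg x.
have key s (z : conf) : lazy_prod h s g [ffun k => z (sg k)] = lazy_prod h (map sg s) g z.
  elim: s z => [|i s IH] z /=; first exact: gsym.
  rewrite /lazy ffunE; apply: eq_bigr => r _; rewrite -IH.
  congr (_ * lazy_prod h s g _); apply/ffunP => k.
  by rewrite !ffunE (inj_eq perm_inj).
rewrite key; congr (_ x); apply: lazy_prod_perm; apply: uniq_perm.
- by rewrite map_inj_uniq ?enum_uniq//; exact: perm_inj.
- exact: enum_uniq.
- move=> k; rewrite mem_enum; apply/mapP; exists (sg^-1%g k) => //.
    by rewrite mem_enum.
  by rewrite permKV.
Qed.

Lemma sum_p_eq u v (F : S -> R) :
  \sum_(y <- nb u) p u y * (y == v)%:R * F y = p u v * F v.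
Proof.
have [vu|vu] := boolP (v \in nb u).
  rewrite (bigD1_seq v)//= eqxx mulr1 big1 ?addr0// => y /negbTE ->.
  by rewrite mulr0 mul0r.
rewrite p_out// mul0r big1_seq// => y /= yu.
by rewrite (negbTE (memPn vu _ yu)) mulr0 mul0r.
Qed.

(** The indicator of [y = x j] collapses the sum over [y] to a single site. *)
Lemma gen_ab_split a b g x : gen_ab p a b g x = gen_ab p a 0 g x +
  b * \sum_(i < n) \sum_(j < n) p (x i) (x j) * (g (jump x i (x j)) - g x).
Proof.
rewrite !gen_abE mulr_sumr -big_split /=; apply: eq_bigr => i _.
under [X in b * X]eq_bigr do rewrite -(sum_p_eq _ _ (fun y => g (jump x i y) - g x)).
rewrite exchange_big /= mulr_sumr -big_split /=; apply: eq_bigr => y _.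
by rewrite -mulr_suml -mulr_sumr /jump_rate; ring.
Qed.

(* The four terms below are the quadratic form of [g] in the variables [i, j],
   evaluated at [delta_(x i) - delta_(x j)]. *)
Lemma attraction_ge0 g x : (forall i j, i != j -> pd_pair i j g) ->
  symmetric_fun g ->
  0 <= \sum_(i < n) \sum_(j < n) p (x i) (x j) * (g (jump x i (x j)) - g x).
Proof.
move=> pdg gsym; set A := \sum_(i < n) _.
(* Exchanging [i] and [j] in one copy of [A] pairs the jump of [i] onto [x j] with the jump of [j]
   onto [x i]. *)
suff : 0 <= A + A by lra.
rewrite {2}/A exchange_big /= -big_split /=; apply: sumr_ge0 => i _.
rewrite -big_split /=; apply: sumr_ge0 => j _.
have [->|ij] := eqVneq i j; first by rewrite p_diag !mul0r addr0.
rewrite (p_sym (x j)) -mulrDr; apply: mulr_ge0 => //.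
have := pdg i j ij x [:: (x i, 1); (x j, -1)].
rewrite !big_cons !big_nil /= !jump_id.
(* Swapping the two values permutes the arguments, so by symmetry both cross terms equal [- g x]. *)
have -> : jump (jump x i (x j)) j (x i) = [ffun k => x (tperm i j k)].
  apply/ffunP => k; rewrite !jumpE ffunE; case: tpermP => [->|->|].
  - by rewrite (negbTE ij) eqxx.
  - by rewrite eqxx.
  - by move=> /eqP/negbTE -> /eqP/negbTE ->.
rewrite gsym [jump (jump _ _ _) _ (x j)](_ : _ = jump x i (x j)); last first.
  by rewrite jumpC// jump_id.
lra.
Qed.
End FiniteJumps.

(** * Reduction to finite supports and finite test families *)

Lemma norm_coord_le (R : realType) (d : nat) (z : 'rV[int]_d) (k : 'I_d) (r : R) :
  euclid_norm R z <= r -> (`|z ord0 k|%N)%:R <= r.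
Proof.
apply: le_trans; rewrite -[leLHS]ger0_norm// -sqrtr_sqr /euclid_norm.
apply: ler_wsqrtr; rewrite (bigD1 k)//= natr_absz intr_norm real_normK ?num_real//.
by rewrite lerDl sumr_ge0// => i _; rewrite exprn_even_ge0.
Qed.

Lemma admissible_walk_support (R : realType) (S : choiceType) (p : S -> S -> R) :
  admissible_walk p -> random_walk p /\
  exists nb : S -> seq S, forall x, uniq (nb x) /\
    forall y, y \notin nb x -> p x y = 0.
Proof.
case=> [T q qw | d q qw _ [r r0 qr]]; split=> //.
  exists (fun=> enum T) => x; split; first exact: enum_uniq.
  by move=> y; rewrite mem_enum.
(* Displacements of norm at most [r] have coordinates between [- m] and [m]; ordinals below
   [2 * m + 1], shifted by [- m], enumerate these values. *)
pose m := Num.bound r.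
pose shift (w : {ffun 'I_d -> 'I_(m.*2.+1)}) : 'rV[int]_d :=
  \row_k ((w k : nat)%:Z - m%:Z).
exists (fun x => undup [seq x - shift w | w <- enum {: {ffun 'I_d -> 'I_(m.*2.+1)}}]) => x.
split; first exact: undup_uniq.
move=> y; rewrite mem_undup => yN; apply: qr; rewrite ltNge; apply: contra yN => le_r.
have [w wE] : exists w, shift w = x - y.
  move: (x - y) le_r => z le_r.
  have coord (k : 'I_d) : (`|z ord0 k|%N <= m)%N.
    have h := le_trans (norm_coord_le k le_r) (ltW (archi_boundP (ltW r0))).
    by rewrite ler_nat in h.
  exists [ffun k => inord (absz (z ord0 k + m%:Z))]; apply/rowP => k.
  have := coord k; rewrite !mxE ffunE; move: (z ord0 k) => c cm;
  rewrite inordK; lia.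
have -> : y = x - shift w by rewrite wE opprB addrC subrK.
by apply: map_f; rewrite mem_enum.
Qed.

(** Adding up the weights of repeated points gives a finitely supported [beta], for which both
    summability conditions hold. *)
Lemma positive_definite2_seq (R : realType) (S : choiceType) (G : S -> S -> R) :
  positive_definite2 G -> forall s : seq (S * R),
  0 <= \sum_(r <- s) \sum_(r' <- s) r.2 * r'.2 * G r.1 r'.1.
Proof.
move=> Gpd s; pose beta u : R := \sum_(r <- s) r.2 * (u == r.1)%:R.
set U := undup (map fst s).
have rU r : r \in s -> r.1 \in U by move=> rs; rewrite mem_undup map_f.
have beta0 u : u \notin U -> beta u = 0.
  move=> uU; rewrite /beta big1_seq// => r /= rs.
  by rewrite eq_sym (negbTE (memPn uU _ (rU _ rs))) mulr0.
have sumU (F : S -> R) : \sum_(u <- U) F u * beta u = \sum_(r <- s) r.2 * F r.1.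
  under eq_bigr do rewrite mulr_sumr.
  rewrite exchange_big /=; apply: eq_big_seq => r rs.
  rewrite (bigD1_seq r.1) ?undup_uniq ?rU//= eqxx mulr1 big1; first by rewrite addr0 mulrC.
  by move=> u /negbTE ->; rewrite !mulr0.
set UU := [seq (u, v) | u <- U, v <- U].
have out (u : S * S) : u \notin UU -> G u.1 u.2 * beta u.1 * beta u.2 = 0.
  case: u => u v uv /=; have [uU|/beta0->] := boolP (u \in U); last by rewrite mulr0 mul0r.
  have [vU|/beta0->] := boolP (v \in U); last by rewrite mulr0.
  by move/negP: uv; case; apply/allpairsP; exists (u, v).
have := Gpd beta (rsummable_fin beta0) (rsummable_fin out).
rewrite (rsum_fin _ out); last first.
  apply: allpairs_uniq; rewrite ?undup_uniq//.
  by move=> [a b] [c d] _ _ /= [-> ->].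
rewrite big_allpairs_dep /=.
under eq_bigr => u _ do rewrite (sumU (fun v => G u v * beta u)).
rewrite exchange_big /=.
under eq_bigr => r' _.
  under eq_bigr do rewrite mulrA.
  rewrite (sumU (fun u => r'.2 * G u r'.1)).
  over.
rewrite exchange_big /=; congr (0 <= _).
by apply: eq_bigr => r _; apply: eq_bigr => r' _; rewrite mulrA.
Qed.

(** * Truncation to finite boxes *)

Section Truncation.
Context {R : realType} {S : choiceType} {n : nat}.
Implicit Types (B : seq S) (f : config n S -> R).

Lemma box_seq B : exists s : seq (config n S),
  uniq s /\ forall x : config n S, (x \in s) = [forall k, x k \in B].
Proof.
exists (undup [seq ([ffun i => ssval (w i)] : config n S)
              | w : {ffun 'I_n -> seq_sub B} <- enum {: {ffun 'I_n -> seq_sub B}}]).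
split; first exact: undup_uniq.
move=> x; rewrite mem_undup; apply/mapP/forallP => [[w _ ->] k|xB].
  by rewrite ffunE; exact: ssvalP.
exists [ffun i => SeqSub (xB i)]; first by rewrite mem_enum.
by apply/ffunP => i; rewrite !ffunE.
Qed.

Definition box_trunc B f (x : config n S) : R :=
  if [forall k, x k \in B] then f x else 0.

Lemma box_trunc_bounded B f : exists M : R, forall x, `|box_trunc B f x| <= M.
Proof.
have [s [us sE]] := box_seq B; exists (\sum_(y <- s) `|f y|) => x.
rewrite /box_trunc -sE; have [xs|_] := boolP (x \in s); last first.
  by rewrite normr0 sumr_ge0.
by rewrite (bigD1_seq x)//= lerDl sumr_ge0.
Qed.

Lemma box_trunc_symmetric B f : symmetric_fun f -> symmetric_fun (box_trunc B f).
Proof.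
move=> fsym s x; rewrite /box_trunc fsym.
suff -> : [forall k, [ffun i => x (s i)] k \in B] = [forall k, x k \in B] by [].
apply/forallP/forallP => h k; last by rewrite ffunE.
by have := h (s^-1%g k); rewrite ffunE permKV.
Qed.

(** The indicator of a box is a product over coordinates. If some other coordinate leaves [B], the
    form vanishes; otherwise truncation multiplies each test weight by the indicator of [B]. *)
Lemma box_trunc_pd_pair B f (i j : 'I_n) : i != j ->
  pd_pair i j f -> pd_pair i j (box_trunc B f).
Proof.
move=> ij fpd x s.
have [xB|xB] := boolP [forall k, (k != i) && (k != j) ==> (x k \in B)]; last first.
  rewrite big1// => r _; rewrite big1// => r' _.
  rewrite /box_trunc ifN ?mulr0//; apply: contra xB => /forallP h.
  apply/forallP => k; apply/implyP => /andP[ki kj].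
  by have := h k; rewrite !jump_other.
pose s' := [seq (r.1, r.2 * (r.1 \in B)%:R) | r <- s].
suff -> : \sum_(r <- s) \sum_(r' <- s)
      r.2 * r'.2 * box_trunc B f (jump (jump x i r.1) j r'.1) =
    \sum_(r <- s') \sum_(r' <- s') r.2 * r'.2 * f (jump (jump x i r.1) j r'.1).
  exact: fpd.
rewrite [RHS]big_map /=; apply: eq_bigr => r _; rewrite [RHS]big_map /=.
apply: eq_bigr => r' _; rewrite /box_trunc.
have -> : [forall k, jump (jump x i r.1) j r'.1 k \in B] = (r.1 \in B) && (r'.1 \in B).
  apply/forallP/andP => [h|[h h'] k].
    split; last by have := h j; rewrite jump_same.
    by have := h i; rewrite jump_other// jump_same.
  have [->|kj] := eqVneq k j; first by rewrite jump_same.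
  rewrite jump_other//; have [->|ki] := eqVneq k i; first by rewrite jump_same.
  by rewrite jump_other//; move/forallP/(_ k)/implyP: xB; apply; rewrite ki.
by case: (r.1 \in B); case: (r'.1 \in B); rewrite /= ?mulr1 ?mulr0 ?mul0r.
Qed.

End Truncation.

(** * Comparison of the semigroups for two values of [b] *)

Section Comparison.
Context {R : realType} {S : choiceType} {n : nat}.
Variables (p : S -> S -> R) (nb : S -> seq S).
Hypothesis p_ge0 : forall x y, 0 <= p x y.
Hypothesis p_sym : forall x y, p x y = p y x.
Hypothesis p_diag : forall x, p x x = 0.
Hypothesis nb_uniq : forall x, uniq (nb x).
Hypothesis p_out : forall x y, y \notin nb x -> p x y = 0.
Hypothesis p_sum1 : forall x, \sum_(y <- nb x) p x y = 1.
Variable a : R.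
Hypothesis a_gt0 : 0 < a.

Local Notation conf := (config n S).
Local Notation gen b := (@gen_ab R S p a b n).

(** The factor [p (x i) y] is kept because, for negative [b], the Markov property controls the rate
    only at sites the walk can jump to. *)
Definition rates_ge0 (b : R) :=
  forall (x : conf) i y, 0 <= p (x i) y * jump_rate a b x y.

Definition gen_bound (b : R) : R := 2 * n%:R * (`|a| + `|b| * n%:R).

Lemma gen_bound_ge0 b : 0 <= gen_bound b.
Proof. by rewrite /gen_bound !mulr_ge0// addr_ge0// mulr_ge0. Qed.

Lemma gen_linear b (c : R) (g h : conf -> R) x :
  gen b (fun z => g z + c * h z) x = gen b g x + c * gen b h x.
Proof. exact: gen_ab_lin. Qed.

Lemma gen_bounded b (g : conf -> R) (M : R) x :
  (forall z, `|g z| <= M) -> `|gen b g x| <= gen_bound b * M.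
Proof. exact: gen_ab_bnd. Qed.

(** Up to small errors, the iterates of the lazy walkers lie between the two Euler schemes. Each
    half of the theorem is an instance with one of [b1], [b2] equal to [0]. *)
Lemma le_expgen_bounded (b1 b2 : R) (f : conf -> R) (M : R) (t : R) x :
  b1 <= 0 -> 0 <= b2 -> rates_ge0 b1 -> rates_ge0 b2 -> 0 <= t ->
  (forall z, `|f z| <= M) ->
  (forall i j : 'I_n, i != j -> pd_pair i j f) -> symmetric_fun f ->
  expgen (gen b1) t f x <= expgen (gen b2) t f x.
Proof.
move=> b1_le0 b2_ge0 r1 r2 t0 fM fpd fsym.
have c1 := euler_cvg (gen_bound_ge0 b1) (@gen_linear b1) (@gen_bounded b1) fM t0 (x := x).
have c2 := euler_cvg (gen_bound_ge0 b2) (@gen_linear b2) (@gen_bounded b2) fM t0 (x := x).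
(* Over [N.+1] steps of length [t / N.+1], the second-order errors add up to [K * harmonic N]; the
   lower and the upper comparison each contribute once. *)
set K := 4 * n%:R ^+ 2 * (a * t) ^+ 2 * M.
have c2' : (fun N => iter N.+1 (euler (gen b2) (t / N.+1%:R)) f x
                     + 2 * K * harmonic N) @ \oo --> expgen (gen b2) t f x.
  rewrite -[X in _ --> X]addr0; apply: cvgD => //.
  by rewrite -[X in _ --> X](mulr0 (2 * K)); apply: cvgMr; exact: cvg_harmonic.
have large (c : R) : \forall N \near \oo, t * c <= N.+1%:R.
  exists (Num.bound (t * c)) => // k /= ck.
  apply: (@le_trans _ _ (Num.bound (t * c))%:R).
    case: (leP 0 (t * c)) => tc; first by rewrite ltW// archi_boundP.
    by apply: (le_trans (ltW tc)).
  by rewrite ler_nat; exact: leqW.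
apply: (ler_cvg_to c1 c2'); near=> N.
have N0 : 0 < N.+1%:R :> R by [].
pose h := t / N.+1%:R.
have h0 : 0 <= h by rewrite divr_ge0.
have small (c : R) : 0 <= c -> t * c <= N.+1%:R -> h * c <= 1.
  by move=> c0 tc; rewrite /h mulrAC ler_pdivrMr// mul1r.
have rate0 (b : R) : 0 <= n%:R * (`|a| + `|b| * n%:R) by rewrite mulr_ge0// addr_ge0// mulr_ge0.
have ah1 : a * h <= 1.
  by rewrite mulrC; apply: small; [exact: ltW|near: N; exact: large].
have h1 : h * (n%:R * (`|a| + `|b1| * n%:R)) <= 1.
  by apply: small; [exact: rate0|near: N; exact: large].
have h2 : h * (n%:R * (`|a| + `|b2| * n%:R)) <= 1.
  by apply: small; [exact: rate0|near: N; exact: large].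
have ah0 : 0 <= a * h by rewrite mulr_ge0// ltW.
pose W := lazy_prod p nb (a * h) (enum 'I_n).
pose e := 4 * n%:R ^+ 2 * (a * h) ^+ 2 * M.
have [WM Wpd Wsym] : [/\ forall k z, `|iter k W f z| <= M,
    forall k i j, i != j -> pd_pair i j (iter k W f) &
    forall k, symmetric_fun (iter k W f)].
  split; elim=> [|k IH] //=.
  - by move=> z; apply: lazy_prod_bnd.
  - by move=> i j ij; apply: pd_pair_lazy_prod => //; exact: IH.
  - exact: symmetric_lazy_prod.
have near0 k z : `|iter k.+1 W f z - euler (gen 0) h (iter k W f) z| <= e.
  by apply: lazy_prod_euler => //; exact: WM.
have order b k z : euler (gen b) h (iter k W f) z =
    euler (gen 0) h (iter k W f) z + h * (b * \sum_(i < n) \sum_(j < n)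
      p (z i) (z j) * (iter k W f (jump z i (z j)) - iter k W f z)).
  by rewrite /euler (gen_ab_split nb_uniq p_out) mulrDr addrA.
have attr k z := attraction_ge0 p_ge0 p_sym p_diag z (Wpd k) (Wsym k).
(* At each iterate of [W] the interaction term has the sign of [b1], so dropping it can only
   increase the Euler step. *)
have lower : iter N.+1 (euler (gen b1) h) f x <= iter N.+1 W f x + N.+1%:R * e.
  apply: iter_ge_perturb.
  - by move=> g g'; exact: euler_mono.
  - by move=> g c z; exact: euler_shift.
  move=> k z; have := near0 k z; rewrite ler_norml => /andP[+ _].
  rewrite (order b1); have := mulr_ge0_le0 h0 (mulr_le0_ge0 b1_le0 (attr k z)).
  lra.
have upper : iter N.+1 W f x <= iter N.+1 (euler (gen b2) h) f x + N.+1%:R * e.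
  apply: iter_le_perturb.
  - by move=> g g'; exact: euler_mono.
  - by move=> g c z; exact: euler_shift.
  move=> k z; have := near0 k z; rewrite ler_norml => /andP[_].
  rewrite (order b2); have := mulr_ge0 h0 (mulr_ge0 b2_ge0 (attr k z)).
  lra.
have -> : 2 * K * harmonic N = 2 * (N.+1%:R * e).
  by rewrite /K /e /h /harmonic /=; field; rewrite gt_eqF.
rewrite -/h; apply: (le_trans lower).
by rewrite [2 * _]mulr_natl mulr2n addrA lerD2r.
Unshelve. all: by end_near. Qed.

(** Both kernel sums are within [e / 2] of their restrictions to one large box, and these
    restrictions are exponentials applied to the truncated function. *)
Lemma le_semigroup (b1 b2 : R) (f : conf -> R) (t : R) x :
  b1 <= 0 -> 0 <= b2 -> rates_ge0 b1 -> rates_ge0 b2 -> 0 <= t ->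
  positive_definite f -> symmetric_fun f ->
  in_semigroup_domain (gen b1) t f x -> in_semigroup_domain (gen b2) t f x ->
  semigroup (gen b1) t f x <= semigroup (gen b2) t f x.
Proof.
move=> b10 b20 r1 r2 t0 fpd fsym d1 d2; apply/ler_addgt0Pr => e e0.
have e20 : 0 < e / 2 :> R by rewrite divr_gt0.
have [F1 F1P] := rsum_approx d1 e20; have [F2 F2P] := rsum_approx d2 e20.
(* [B] collects every coordinate of every configuration in [F1] and [F2], so the box over [B]
   contains both families. *)
pose B := flatten [seq [seq z k | k <- enum 'I_n] | z : conf <- F1 ++ F2].
have [s [us sE]] := box_seq (n := n) B.
have sub z : z \in F1 ++ F2 -> z \in s.
  move=> zF; rewrite sE; apply/forallP => k; apply/flattenP.
  exists [seq z k | k <- enum 'I_n]; first by apply/mapP; exists z.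
  by apply: map_f; rewrite mem_enum.
have truncE b : expgen (gen b) t (box_trunc B f) x =
    \sum_(y <- s) transition (gen b) t x y * f y.
  rewrite (expgen_transition (@gen_linear b) (@gen_bounded b)
    _ t0 us); last by move=> y; rewrite sE /box_trunc => /negbTE ->.
  by apply: eq_big_seq => y; rewrite sE /box_trunc => ->.
have close (A A' C C' : R) : `|A - A'| <= e / 2 -> `|C - C'| <= e / 2 -> A' <= C' ->
    A <= C + e.
  by rewrite !ler_norml => /andP[h1 h2] /andP[h3 h4] h; lra.
apply: close (F1P s us (fun z zF => sub z ltac:(by rewrite mem_cat zF)))
  (F2P s us (fun z zF => sub z ltac:(by rewrite mem_cat zF orbT))) _.
rewrite -!truncE; have [M fM] := box_trunc_bounded B f.
apply: le_expgen_bounded fM _ _ => //; last exact: box_trunc_symmetric.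
move=> i j ij; apply: box_trunc_pd_pair => // z r.
exact: positive_definite2_seq (fpd i j ij z) r.
Qed.

(* The off-diagonal entries of the generator are the derivatives at [0] of the
   transition probabilities, which a Markov semigroup keeps nonnegative. *)
Lemma markov_rates_ge0 b :
  markov_semigroup (semigroup_T p a b (n := n)) -> rates_ge0 b.
Proof.
move=> mk x i y; have [yx|yx] := eqVneq y (x i); first by rewrite yx p_diag mul0r.
pose y' := jump x i y; pose g z : R := (z == y')%:R.
have g1 z : `|g z| <= 1 by rewrite /g; case: eqP; rewrite ?normr1 ?normr0.
have y'x : (x == y') = false.
  apply/negP => /eqP /ffunP /(_ i); rewrite /y' jump_same => xy.
  by rewrite xy eqxx in yx.
(* The target [y'] differs from [x] at [i] only, so it is reached solely by moving coordinate [i] to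
   [y]. *)
have Lg : gen b g x = p (x i) y * jump_rate a b x y.
  rewrite (gen_abE nb_uniq p_out) (bigD1 i)//= [X in _ + X]big1 ?addr0; last first.
    move=> k ki; rewrite big1// => z _; rewrite /g y'x subr0.
    suff -> : (jump x k z == y') = false by rewrite mulr0.
    apply/negP => /eqP /ffunP /(_ i); rewrite /y' jump_same jump_other 1?eq_sym// => xy.
    by rewrite xy eqxx in yx.
  rewrite -(sum_p_eq nb_uniq p_out (x i) y (jump_rate a b x)).
  apply: eq_bigr => z _; rewrite /g y'x subr0 mulrAC; congr (_ * _%:R * _).
  congr nat_of_bool; apply/eqP/eqP => [/ffunP /(_ i)|->//].
  by rewrite /y' !jump_same.
rewrite -Lg leNgt; apply/negP => neg.
have tr0 t : 0 <= t -> 0 <= expgen (gen b) t g x.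
  move=> t0; have [_ pos] := mk t t0.
  have := pos g (ex_intro _ 1 g1) (fun z => ler0n _ _) x.
  rewrite /semigroup_T /semigroup (@rsum_fin _ _ [:: y'])//.
    by rewrite big_seq1 /g eqxx mulr1.
  by move=> z; rewrite inE /g => /negbTE ->; rewrite mulr0.
set C := gen_bound b; have C0 : 0 <= C := gen_bound_ge0 b.
pose D := expR 1 * C ^+ 2; have D0 : 0 <= D by rewrite mulr_ge0 ?expR_ge0 ?exprn_ge0.
pose l := - gen b g x; have l0 : 0 < l by rewrite oppr_gt0.
(* The first bound gives [t * C <= 1], as the first-order estimate requires; the second makes the
   error [t * (t * D)] smaller than [t * l], which would force a negative transition probability.
   Adding [1] keeps the denominators positive. *)
pose t := Num.min (C + 1)^-1 (l / (2 * (D + 1))).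
have t_gt0 : 0 < t by rewrite lt_min invr_gt0 ltr_pwDr// divr_gt0// mulr_gt0// ltr_pwDr.
have tC : t * C <= 1.
  apply: (@le_trans _ _ ((C + 1)^-1 * C)); first by rewrite ler_wpM2r// ge_min lexx.
  by rewrite ler_pdivrMl ?ltr_pwDr// mulr1 lerDl.
have tD : t * (2 * (D + 1)) <= l.
  by rewrite -ler_pdivlMr ?mulr_gt0 ?ltr_pwDr// ge_min lexx orbT.
have := expgen_first_order_le C0 (@gen_linear b) (@gen_bounded b) g1 (ltW t_gt0) x tC.
have := tr0 t (ltW t_gt0).
rewrite ler_norml => p0 /andP[_]; rewrite {2}/g y'x add0r.
have -> : 1 * expR 1 * (t * C) ^+ 2 = t * (t * D) by rewrite /D; ring.
have -> : t * gen b g x = - (t * l) by rewrite /l mulrN opprK.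
move=> h; have tl : t * l <= t * (t * D) by lra.
by rewrite ler_pM2l// in tl; nra.
Qed.

End Comparison.

Theorem theorem1 (R : realType) (S : choiceType) (p : S -> S -> R)
    (hp : admissible_walk p) (a b : R) (ha : 0 < a) (n : nat) (hn : (0 < n)%N)
    (f : config n S -> R) (fpd : positive_definite f) (fsym : symmetric_fun f) :
  (0 < b ->
     forall (t : R) (x : config n S), 0 <= t ->
       in_semigroup_domain (gen_1 p a (n := n)) t f x ->
       in_semigroup_domain (gen_ab p a b (n := n)) t f x ->
       semigroup_U p a t f x <= semigroup_T p a b t f x) /\
  (b < 0 -> markov_semigroup (semigroup_T p a b (n := n)) ->
     forall (t : R) (x : config n S), 0 <= t ->
       in_semigroup_domain (gen_1 p a (n := n)) t f x ->
       in_semigroup_domain (gen_ab p a b (n := n)) t f x ->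
       semigroup_T p a b t f x <= semigroup_U p a t f x).
Proof.
have [[p0 psym psum pdiag _] [nb nbP]] := admissible_walk_support hp.
have nbu x : uniq (nb x) by case: (nbP x).
have pout x y : y \notin nb x -> p x y = 0 by case: (nbP x) => _; apply.
have psum1 x : \sum_(y <- nb x) p x y = 1.
  by rewrite -(rsum_fin (nbu x) (pout x)); case: (psum x).
have gen1 : gen_1 p a (n := n) = gen_ab p a 0 (n := n).
  by apply/funext => g; apply/funext => x; rewrite (gen_1E nbu pout).
have rate b' : 0 <= b' -> rates_ge0 (n := n) p a b'.
  move=> b'0 x i y; by rewrite mulr_ge0// addr_ge0 ?(ltW ha)// mulr_ge0// sumr_ge0.
(* For [b > 0] the pair compared is [0], [b], with rates visibly nonnegative; for [b < 0] it is [b],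
   [0], and the Markov hypothesis supplies the nonnegative rates. *)
rewrite /semigroup_U /semigroup_T gen1; split=> [b0|b0 mk] t x t0 d1 d2.
  by apply: (@le_semigroup _ _ _ p nb) => //; [exact: ltW|exact: rate|apply: rate; exact: ltW].
apply: (@le_semigroup _ _ _ p nb) => //; [exact: ltW| |exact: rate].
exact: (markov_rates_ge0 (nb := nb)).
Qed.
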